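(* Let $\beta,\gamma,r_0>0$ and let $\nu>0$ be such that the normalized modulation frequency $\tilde\nu=\nu/\left(r_0\sqrt{\gamma/\beta}\right)$ satisfies $0<\tilde\nu<\sqrt2$. Put $T=2\pi/\nu$. Let $\phi\in\mathbb{R}$ satisfy $2\cos^2\phi>\tilde\nu^2$. Let $Q(\phi)$ be a real number with $$Q^2(\phi)=\frac{2\cos^2\phi}{2\cos^2\phi-\tilde\nu^2},\qquad\text{and set}\qquad P(\phi)=\frac{\tilde\nu^2\,Q(\phi)}{\cos\phi}.$$ Then the $T$-periodic function $$G(\phi,\tau)=\frac{P(\phi)}{Q(\phi)-\cos(\nu\tau)}$$ is a solution of the constrained variational problem $$\mathrm{Crit}_G\left\{\int_{-T/2}^{T/2}\tfrac12G^2\,d\tau\ \Big|\ \bar H(G,\phi)=0\right\}$$ with multiplier $$\lambda=\gamma r_0^2\left(\tilde\nu^2-2\cos^2\phi\right).$$ That is, $G$ satisfies the constraint $\bar H(G,\phi)=0$ and, for all $\tau\in\mathbb{R}$, the multiplier equation $$\beta\,\partial_\tau^2G+\lambda G+\gamma r_0^2\,G\,(G-\cos\phi)(G-2\cos\phi)=0$$ with this value of $\lambda$.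
   Context: For a smooth real-valued $T$-periodic function $G$ of $\tau$ and a fixed real number $\phi$, $$\bar H(G,\phi)=\int_{-T/2}^{T/2}\left[-\beta(\partial_\tau G)^2+W(G,\phi)\right]d\tau,\qquad W(G,\phi)=\tfrac12\gamma r_0^2\,G^2(G-2\cos\phi)^2.$$ For fixed $\phi$, $\mathrm{Crit}_G\{\int\frac12G^2\,d\tau\mid\bar H(G,\phi)=0\}$ denotes the problem of finding the $T$-periodic functions $G$ that are critical (stationary) points of $\int_{-T/2}^{T/2}\frac12G^2\,d\tau$ subject to the constraint $\bar H(G,\phi)=0$. Nontrivial solutions are characterized by the constraint together with the Lagrange multiplier equation, which in detail reads $\beta\,\partial_\tau^2G+\lambda G+\gamma r_0^2G(G-\cos\phi)(G-2\cos\phi)=0$ for some real number $\lambda=\lambda(\phi)$, called the multiplier. Here $\phi$ is a parameter not depending on $\tau$. *)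

(* Defs.v *)
(* Stdlib real numbers with Coquelicot. *)
From Stdlib Require Import Reals.
From Coquelicot Require Import Coquelicot.
Open Scope R_scope.

Definition smooth_periodic (T : R) (G : R -> R) : Prop :=
  (forall (n : nat) (t : R), ex_derive_n G n t) /\
  (forall t : R, G (t + T) = G t).

Definition W (gamma r0 g phi : R) : R :=
  / 2 * gamma * r0 ^ 2 * (g ^ 2 * (g - 2 * cos phi) ^ 2).

Definition Hbar (beta gamma r0 T : R) (G : R -> R) (phi : R) : R :=
  RInt (fun t => - beta * (Derive G t) ^ 2 + W gamma r0 (G t) phi)
       (- T / 2) (T / 2).

Definition momentum (T : R) (G : R -> R) : R :=
  RInt (fun t => / 2 * (G t) ^ 2) (- T / 2) (T / 2).

(* [G] solves Crit_G { F | K = 0 } over the smooth [T]-periodic functions: it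
   is admissible, and the first variation of [F] at [G] vanishes in every
   direction in which the first variation of [K] at [G] vanishes. *)
Definition constrained_critical (T : R) (F K : (R -> R) -> R) (G : R -> R)
  : Prop :=
  smooth_periodic T G /\
  K G = 0 /\
  (forall h : R -> R, smooth_periodic T h ->
     is_derive (fun e : R => K (fun t => G t + e * h t)) 0 0 ->
     is_derive (fun e : R => F (fun t => G t + e * h t)) 0 0).

Definition multiplier_equation
  (beta gamma r0 phi lambda : R) (G : R -> R) : Prop :=
  forall t : R,
    beta * Derive_n G 2 t + lambda * G t
      + gamma * r0 ^ 2 * G t * (G t - cos phi) * (G t - 2 * cos phi) = 0.

(* Main.v *)
(* Any smooth periodic solution of the multiplier equation with nonzero
   multiplier is critical: integrating by parts turns the first variation of
   [Hbar] at [G] into [- 2 lambda] times the integral of [G h], that is, into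
   [- 2 lambda] times the first variation of the momentum.

   For [G = P / (Q - cos s)], [s = nu tau], the parameters satisfy
   [P^2 = 2 nut^2 (Q^2 - 1)] and [nut^2 Q = P cos phi]; with these relations the
   multiplier equation is a rational identity, and the integrand of [Hbar] is
   the derivative of [sin s] times a polynomial in [1 / (Q - cos s)], which
   vanishes at both ends of the period. *)
Require Import Defs.
From Stdlib Require Import Reals Lra ssreflect.
From Coquelicot Require Import Coquelicot.
Open Scope R_scope.

(** * Smoothness of rational trigonometric functions *)

(** By induction every [Derive_n f n] agrees pointwise with a member of [C], so closure under one
    differentiation yields all orders without a formula for the n-th derivative. *)
Lemma ex_derive_n_of_stable (C : (R -> R) -> Prop) :
  (forall f, C f -> exists g, C g /\ forall t, is_derive f t (g t)) ->
  forall f, C f -> forall n t, ex_derive_n f n t.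
Proof.
  intros HC f Hf.
  assert (HD : forall n, exists g, C g /\ forall t, Derive_n f n t = g t).
  { induction n as [|n [g [Cg Eg]]].
    - exists f; auto.
    - destruct (HC g Cg) as [g' [Cg' Hg']].
      exists g'; split; [exact Cg'|intros t; simpl].
      rewrite (Derive_ext _ g t Eg).
      now apply is_derive_unique. }
  intros [|n] t; simpl; [exact I|].
  destruct (HD n) as [g [Cg Eg]].
  destruct (HC g Cg) as [g' [_ Hg']].
  apply (ex_derive_ext g); [intros s; now rewrite Eg|].
  exists (g' t); apply Hg'.
Qed.

(** An algebra that contains [G] and is closed under differentiation: the derivative of the
    reciprocal is [- nu * sin (nu * t)] times its square. *)
Inductive trig_poly_inv (nu Q : R) : (R -> R) -> Prop :=
| tpi_const (c : R) : trig_poly_inv nu Q (fun _ => c)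
| tpi_cos : trig_poly_inv nu Q (fun t => cos (nu * t))
| tpi_sin : trig_poly_inv nu Q (fun t => sin (nu * t))
| tpi_inv : trig_poly_inv nu Q (fun t => / (Q - cos (nu * t)))
| tpi_plus (f g : R -> R) : trig_poly_inv nu Q f -> trig_poly_inv nu Q g ->
    trig_poly_inv nu Q (fun t => f t + g t)
| tpi_mult (f g : R -> R) : trig_poly_inv nu Q f -> trig_poly_inv nu Q g ->
    trig_poly_inv nu Q (fun t => f t * g t).

Lemma trig_poly_inv_derive (nu Q : R) :
  (forall t, Q - cos (nu * t) <> 0) ->
  forall f, trig_poly_inv nu Q f ->
  exists g, trig_poly_inv nu Q g /\ forall t, is_derive f t (g t).
Proof.
  intros HD f Hf.
  induction Hf as [c| | | |f g Hf [f' [Cf Df]] Hg [g' [Cg Dg]]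
                  |f g Hf [f' [Cf Df]] Hg [g' [Cg Dg]]].
  - exists (fun _ => 0); split; [constructor|].
    intros t; auto_derive; auto.
  - exists (fun t => - nu * sin (nu * t)); split.
    + apply (tpi_mult nu Q (fun _ => - nu)); constructor.
    + intros t; auto_derive; auto; ring.
  - exists (fun t => nu * cos (nu * t)); split.
    + apply (tpi_mult nu Q (fun _ => nu)); constructor.
    + intros t; auto_derive; auto; ring.
  - exists (fun t => (- nu * sin (nu * t))
                     * (/ (Q - cos (nu * t)) * / (Q - cos (nu * t)))); split.
    + apply (tpi_mult nu Q (fun t => - nu * sin (nu * t))).
      * apply (tpi_mult nu Q (fun _ => - nu)); constructor.
      * apply (tpi_mult nu Q (fun t => / (Q - cos (nu * t)))); constructor.
    + intros t; specialize (HD t).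
      auto_derive; [exact HD|now field].
  - exists (fun t => f' t + g' t); split; [now constructor|].
    intros t; exact (is_derive_plus f g t _ _ (Df t) (Dg t)).
  - exists (fun t => f' t * g t + f t * g' t); split.
    + apply (tpi_plus nu Q (fun t => f' t * g t)); now constructor.
    + intros t; apply (is_derive_mult f g t _ _ (Df t) (Dg t)).
      exact Rmult_comm.
Qed.

(** * First variations of the momentum and of [Hbar] *)

(** By linearity the integral is itself a polynomial in [e], so no differentiation under the
    integral sign is involved. Degree four suffices because [W] is quartic in [g]. *)
Lemma is_derive_RInt_quartic (f0 f1 f2 f3 f4 : R -> R) (a b : R) :
  (forall t, continuous f0 t) -> (forall t, continuous f1 t) ->
  (forall t, continuous f2 t) -> (forall t, continuous f3 t) ->
  (forall t, continuous f4 t) ->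
  is_derive (fun e => RInt (fun t => f0 t + e * f1 t + e ^ 2 * f2 t
                                     + e ^ 3 * f3 t + e ^ 4 * f4 t) a b)
            0 (RInt f1 a b).
Proof.
  intros H0 H1 H2 H3 H4.
  assert (HI : forall f : R -> R, (forall t, continuous f t) ->
                 is_RInt f a b (RInt f a b)).
  { intros f Hf; apply: RInt_correct; apply: ex_RInt_continuous; auto. }
  apply (is_derive_ext
    (fun e => RInt f0 a b + e * RInt f1 a b + e ^ 2 * RInt f2 a b
              + e ^ 3 * RInt f3 a b + e ^ 4 * RInt f4 a b)).
  - intros e; symmetry; apply is_RInt_unique.
    repeat apply: is_RInt_plus; try apply: is_RInt_scal; now apply HI.
  - generalize (RInt f0 a b) (RInt f1 a b) (RInt f2 a b) (RInt f3 a b)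
      (RInt f4 a b); simpl; intros x0 x1 x2 x3 x4.
    auto_derive; auto; ring.
Qed.

Lemma smooth_periodic_ex_derive (T : R) (G : R -> R) (t : R) :
  smooth_periodic T G -> ex_derive G t.
Proof. intros [HG _]; exact (HG 1%nat t). Qed.

Lemma smooth_periodic_continuous (T : R) (G : R -> R) (t : R) :
  smooth_periodic T G -> continuous G t.
Proof.
  intros HG; apply: ex_derive_continuous.
  exact (smooth_periodic_ex_derive T G t HG).
Qed.

Lemma smooth_periodic_Derive (T : R) (G : R -> R) :
  smooth_periodic T G -> smooth_periodic T (Derive G).
Proof.
  intros [HG HT]; split.
  - intros n t.
    destruct n as [|n]; [exact I|].
    apply (ex_derive_ext (Derive_n G (S n))); [|exact (HG (S (S n)) t)].
    intros s; rewrite <- PeanoNat.Nat.add_1_r.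
    symmetry; exact (Derive_n_comp G n 1 s).
  - intros t.
    rewrite <- (Derive_ext _ _ t HT).
    symmetry; apply is_derive_unique.
    evar_last; [apply (is_derive_comp G (fun s => s + T))|].
    + apply Derive_correct; exact (HG 1%nat (t + T)).
    + auto_derive; auto.
    + simpl; unfold scal; simpl; unfold mult; simpl; ring.
Qed.

(** Recognises only sums, products and constants; hence the integrands below use [+ -] and repeated
    products in place of subtraction and powers. *)
Ltac prove_continuous :=
  repeat match goal with
  | |- continuous (fun _ => _ + _) _ => apply: continuous_plus
  | |- continuous (fun _ => _ * _) _ => apply: continuous_mult
  | |- continuous (fun _ => ?c) _ => apply: continuous_const
  end; auto.

Lemma momentum_first_variation (T : R) (G h : R -> R) :
  smooth_periodic T G -> smooth_periodic T h ->
  is_derive (fun e => momentum T (fun t => G t + e * h t)) 0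
            (RInt (fun t => G t * h t) (- T / 2) (T / 2)).
Proof.
  intros HG Hh.
  pose proof (fun t => smooth_periodic_continuous T G t HG) as CG.
  pose proof (fun t => smooth_periodic_continuous T h t Hh) as Ch.
  eapply is_derive_ext;
    [|apply (is_derive_RInt_quartic (fun t => / 2 * (G t * G t))
        (fun t => G t * h t) (fun t => / 2 * (h t * h t))
        (fun _ => 0) (fun _ => 0)); intros t; prove_continuous].
  intros e; apply RInt_ext; intros t _; simpl; field.
Qed.

(** The second term is [h] times the derivative of [W] in [g], which factors as [2 * gamma * r0 ^ 2
    * g * (g - cos phi) * (g - 2 * cos phi)]. *)
Lemma Hbar_first_variation (beta gamma r0 T phi : R) (G h : R -> R) :
  smooth_periodic T G -> smooth_periodic T h ->
  is_derive (fun e => Hbar beta gamma r0 T (fun t => G t + e * h t) phi) 0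
    (RInt (fun t => -2 * beta * (Derive G t * Derive h t)
                    + 2 * (gamma * r0 ^ 2)
                      * (G t * (G t + - cos phi) * (G t + - 2 * cos phi) * h t))
          (- T / 2) (T / 2)).
Proof.
  intros HG Hh.
  pose proof (fun t => smooth_periodic_continuous T G t HG) as CG.
  pose proof (fun t => smooth_periodic_continuous T h t Hh) as Ch.
  pose proof (fun t => smooth_periodic_continuous T _ t
                         (smooth_periodic_Derive T G HG)) as CG'.
  pose proof (fun t => smooth_periodic_continuous T _ t
                         (smooth_periodic_Derive T h Hh)) as Ch'.
  set (c := cos phi); set (k := gamma * r0 ^ 2).
  eapply is_derive_ext;
    (* The coefficients of [e ^ 0] to [e ^ 4]: the Taylor expansion of [W] at [G t], plus the
       expanded square of the derivative. *)
    [|apply (is_derive_RInt_quartic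
        (fun t => - beta * (Derive G t * Derive G t)
                  + / 2 * k * (G t * G t * ((G t + - 2 * c) * (G t + - 2 * c))))
        (fun t => -2 * beta * (Derive G t * Derive h t)
                  + 2 * k * (G t * (G t + - c) * (G t + - 2 * c) * h t))
        (fun t => - beta * (Derive h t * Derive h t)
                  + k * ((3 * (G t * G t) + - 6 * c * G t + 2 * c * c)
                         * (h t * h t)))
        (fun t => k * (2 * (G t + - c) * (h t * h t * h t)))
        (fun t => / 2 * k * (h t * h t * h t * h t)));
      intros t; prove_continuous].
  intros e; apply RInt_ext; intros t _.
  assert (E : Derive (fun s => G s + e * h s) t = Derive G t + e * Derive h t).
  { apply is_derive_unique; auto_derive; [|now rewrite !Rmult_1_l].
    split; [|split; [|exact I]]; now apply (smooth_periodic_ex_derive T). }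
  rewrite E; unfold W; fold c; unfold k; simpl; field.
Qed.

(** * Criticality from the multiplier equation *)

Lemma multiplier_constrained_critical
  (beta gamma r0 T phi lambda : R) (G : R -> R) :
  lambda <> 0 -> smooth_periodic T G -> Hbar beta gamma r0 T G phi = 0 ->
  multiplier_equation beta gamma r0 phi lambda G ->
  constrained_critical T (momentum T)
    (fun g => Hbar beta gamma r0 T g phi) G.
Proof.
  intros Hl HG HK Hm; split; [exact HG|split; [exact HK|]].
  intros h Hh HKh.
  pose proof (fun t => smooth_periodic_continuous T G t HG) as CG.
  pose proof (fun t => smooth_periodic_continuous T h t Hh) as Ch.
  pose proof (smooth_periodic_Derive T G HG) as HG'.
  pose proof (smooth_periodic_Derive T h Hh) as Hh'.
  pose proof (fun t => smooth_periodic_continuous T _ t HG') as CG'.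
  pose proof (fun t => smooth_periodic_continuous T _ t Hh') as Ch'.
  pose proof (Hbar_first_variation beta gamma r0 T phi G h HG Hh) as HV.
  apply is_derive_unique in HKh.
  pose proof (is_derive_unique _ _ _ HV) as HV0; rewrite HKh in HV0; clear HV HKh.
  (* [f] is the integrand of the first variation of [Hbar]; the assumption on [h] makes its integral
     zero. *)
  set (f := fun t => _) in HV0.
  assert (Hf : is_RInt f (- T / 2) (T / 2) 0).
  { rewrite HV0; apply: RInt_correct; apply: ex_RInt_continuous.
    intros t _; unfold f; prove_continuous. }
  assert (Hgh : is_RInt (fun t => G t * h t) (- T / 2) (T / 2)
                  (RInt (fun t => G t * h t) (- T / 2) (T / 2))).
  { apply: RInt_correct; apply: ex_RInt_continuous.
    intros t _; prove_continuous. }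
  set (I := RInt (fun t => G t * h t) (- T / 2) (T / 2)) in *.
  assert (Hparts : is_RInt (fun t => f t + 2 * lambda * (G t * h t))
                     (- T / 2) (T / 2) 0).
  { evar_last.
    (* Integration by parts: once [beta * G''] is replaced through the multiplier equation, the
       derivative of this product is exactly the integrand. *)
    - apply (is_RInt_derive (fun t => - 2 * beta * (Derive G t * h t))).
      + intros t _.
        evar_last.
        * auto_derive; [|reflexivity].
          split; [|split; [|exact Logic.I]].
          -- exact (smooth_periodic_ex_derive T _ t HG').
          -- exact (smooth_periodic_ex_derive T _ t Hh).
        * change (Derive (fun x => Derive G x) t) with (Derive (Derive G) t).
          change (Derive (fun x => h x) t) with (Derive h t).
          unfold f; simpl.
          assert (E : beta * Derive (Derive G) t
                      = - (lambda * G t + gamma * r0 ^ 2 * G t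
                           * (G t - cos phi) * (G t - 2 * cos phi))).
          { specialize (Hm t).
            change (Derive_n G 2 t) with (Derive (Derive G) t) in Hm; lra. }
          transitivity (- 2 * (beta * Derive (Derive G) t) * h t
                        - 2 * beta * (Derive G t * Derive h t));
            [|rewrite E]; ring.
      + intros t _; unfold f; prove_continuous.
    - unfold minus, plus, opp; simpl.
      (* The endpoints differ by one period, so the boundary terms cancel. *)
      replace (T / 2) with (- T / 2 + T) by field.
      rewrite (proj2 HG') (proj2 Hh); ring. }
  assert (Hsum : is_RInt (fun t => f t + 2 * lambda * (G t * h t))
                   (- T / 2) (T / 2) (0 + 2 * lambda * I)).
  { apply: is_RInt_plus; [exact Hf|]; now apply: is_RInt_scal. }
  pose proof (is_RInt_unique _ _ _ _ Hparts) as E1.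
  rewrite (is_RInt_unique _ _ _ _ Hsum) in E1.
  (* The same integral equals both [0] and [2 * lambda * I]. *)
  assert (EI : I = 0) by (apply (Rmult_eq_reg_l lambda); lra).
  pose proof (momentum_first_variation T G h HG Hh) as HM.
  fold I in HM; now rewrite EI in HM.
Qed.

(** * The profile [P / (Q - cos (nu * t))] *)

Lemma periodic_const_div_minus_cos (nu T P Q t : R) :
  nu * T = 2 * PI ->
  P / (Q - cos (nu * (t + T))) = P / (Q - cos (nu * t)).
Proof.
  intros HT.
  now rewrite Rmult_plus_distr_l HT -(cos_period (nu * t) 1) Rmult_1_r.
Qed.

Lemma is_derive_const_div_minus_cos (nu P Q t : R) :
  Q - cos (nu * t) <> 0 ->
  is_derive (fun s => P / (Q - cos (nu * s))) t
    (- nu * P * sin (nu * t) / (Q - cos (nu * t)) ^ 2).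
Proof. intros HD; auto_derive; [exact HD|now field]. Qed.

(** The squared sine is eliminated, which leaves a rational function of [cos (nu * t)] alone. *)
Lemma Derive2_const_div_minus_cos (nu P Q t : R) :
  (forall s, Q - cos (nu * s) <> 0) ->
  Derive_n (fun s => P / (Q - cos (nu * s))) 2 t
  = nu ^ 2 * P * (- cos (nu * t) / (Q - cos (nu * t)) ^ 2
                  + 2 * (1 - cos (nu * t) ^ 2) / (Q - cos (nu * t)) ^ 3).
Proof.
  intros HD.
  change (Derive (Derive (fun s => P / (Q - cos (nu * s)))) t
    = nu ^ 2 * P * (- cos (nu * t) / (Q - cos (nu * t)) ^ 2
                    + 2 * (1 - cos (nu * t) ^ 2) / (Q - cos (nu * t)) ^ 3)).
  rewrite (Derive_ext _ _ t
    (fun s => is_derive_unique _ _ _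
                (is_derive_const_div_minus_cos nu P Q s (HD s)))).
  apply is_derive_unique.
  replace (1 - cos (nu * t) ^ 2) with (sin (nu * t) ^ 2)
    by (rewrite -!Rsqr_pow2 sin2; reflexivity).
  specialize (HD t).
  auto_derive; [|now field].
  apply Rmult_integral_contrapositive_currified; [exact HD|].
  now rewrite Rmult_1_r.
Qed.

Lemma smooth_periodic_const_div_minus_cos (nu T P Q : R) :
  nu * T = 2 * PI -> (forall t, Q - cos (nu * t) <> 0) ->
  smooth_periodic T (fun t => P / (Q - cos (nu * t))).
Proof.
  intros HT HD; split.
  - apply (ex_derive_n_of_stable _ (trig_poly_inv_derive nu Q HD)).
    apply (tpi_mult nu Q (fun _ => P)); constructor.
  - intros t; now apply periodic_const_div_minus_cos.
Qed.

(** Here [a] stands for [nut ^ 2]. *)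
Lemma multiplier_equation_const_div_minus_cos
  (beta gamma r0 phi nu a P Q : R) :
  beta * nu ^ 2 = gamma * r0 ^ 2 * a -> a * Q = P * cos phi ->
  P ^ 2 = 2 * a * (Q ^ 2 - 1) -> (forall t, Q - cos (nu * t) <> 0) ->
  multiplier_equation beta gamma r0 phi (gamma * r0 ^ 2 * (a - 2 * cos phi ^ 2))
    (fun t => P / (Q - cos (nu * t))).
Proof.
  intros Hb HQ HP HD t.
  rewrite (Derive2_const_div_minus_cos nu P Q t HD).
  specialize (HD t).
  set (c := cos phi) in *; set (x := cos (nu * t)) in *.
  set (k := gamma * r0 ^ 2) in *.
  transitivity (P / (Q - x) ^ 3
    * (beta * nu ^ 2 * (2 * (1 - x ^ 2) - x * (Q - x))
       + k * (a - 2 * c ^ 2) * (Q - x) ^ 2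
       + k * (P - c * (Q - x)) * (P - 2 * c * (Q - x)))); [now field|].
  rewrite Hb.
  (* The numerator is a combination of the two parameter relations, so it vanishes. *)
  transitivity (k * P / (Q - x) ^ 3
    * ((P ^ 2 - 2 * a * (Q ^ 2 - 1)) + 3 * (Q - x) * (a * Q - P * c))).
  - now field.
  - rewrite HP HQ; now field.
Qed.

Lemma Hbar_const_div_minus_cos (beta gamma r0 phi nu T a P Q : R) :
  nu <> 0 -> nu * T = 2 * PI ->
  beta * nu ^ 2 = gamma * r0 ^ 2 * a -> a * Q = P * cos phi ->
  P ^ 2 = 2 * a * (Q ^ 2 - 1) -> (forall t, Q - cos (nu * t) <> 0) ->
  Hbar beta gamma r0 T (fun t => P / (Q - cos (nu * t))) phi = 0.
Proof.
  intros Hnu HT Hb HQ HP HD.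
  pose proof (smooth_periodic_const_div_minus_cos nu T P Q HT HD) as HG.
  set (G := fun t => P / (Q - cos (nu * t))) in *.
  pose proof (fun t => smooth_periodic_continuous T G t HG) as CG.
  pose proof (fun t => smooth_periodic_continuous T _ t
                         (smooth_periodic_Derive T G HG)) as CG'.
  set (c := cos phi) in *; set (k := gamma * r0 ^ 2) in *.
  (* Found by undetermined coefficients. With [D = Q - cos (nu * t)], the parameter relations turn
     the integrand into [k * a ^ 2] times [4 * (Q ^ 2 - 1) ^ 2 / D ^ 4 - 8 * Q * (Q ^ 2 - 1) / D ^ 3
     + (4 * Q ^ 2 - 2) / D ^ 2]. Matching powers of [D] fixes the three coefficients. *)
  set (F := fun t => k / nu * sin (nu * t)
    * (4 / 3 * a ^ 2 * (Q ^ 2 - 1) / (Q - cos (nu * t)) ^ 3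
       - 2 / 3 * a ^ 2 * Q / (Q - cos (nu * t)) ^ 2
       - 2 / 3 * a ^ 2 / (Q - cos (nu * t)))).
  assert (HF : is_RInt
    (fun t => - beta * (Derive G t * Derive G t)
              + / 2 * k * (G t * G t * ((G t + - 2 * c) * (G t + - 2 * c))))
    (- T / 2) (T / 2) (F (T / 2) - F (- T / 2))).
  { apply (is_RInt_derive F); intros t _; [|prove_continuous].
    specialize (HD t).
    assert (E : Derive G t
                = - nu * P * sin (nu * t) / (Q - cos (nu * t)) ^ 2)
      by now apply is_derive_unique, is_derive_const_div_minus_cos.
    rewrite E; unfold F, G.
    auto_derive.
    { repeat split; auto;
        repeat apply Rmult_integral_contrapositive_currified; auto; lra. }
    set (x := cos (nu * t)) in *; set (y := sin (nu * t)).
    assert (Hy : y ^ 2 = 1 - x ^ 2)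
      by (unfold x, y; rewrite -!Rsqr_pow2 sin2; reflexivity).
    transitivity (k * / (Q - x) ^ 4
      * (x * (4 / 3 * a ^ 2 * (Q ^ 2 - 1) * (Q - x)
              - 2 / 3 * a ^ 2 * Q * (Q - x) ^ 2 - 2 / 3 * a ^ 2 * (Q - x) ^ 3)
         - y ^ 2 * (4 * a ^ 2 * (Q ^ 2 - 1) - 4 / 3 * a ^ 2 * Q * (Q - x)
                    - 2 / 3 * a ^ 2 * (Q - x) ^ 2))); [now field|].
    (* Arranged so that [P] enters only through [P ^ 2] and [P * c], and [beta] only through
       [beta * nu ^ 2], ready for the parameter relations. *)
    transitivity (/ (Q - x) ^ 4
      * (- (beta * nu ^ 2) * P ^ 2 * y ^ 2
         + / 2 * k * (P ^ 2 * P ^ 2 - 4 * P ^ 2 * (P * c) * (Q - x)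
                      + 4 * (P * c) ^ 2 * (Q - x) ^ 2))); [|now field].
    rewrite Hb HP -HQ Hy; now field. }
  unfold Hbar.
  rewrite (RInt_ext _
    (fun t => - beta * (Derive G t * Derive G t)
              + / 2 * k * (G t * G t * ((G t + - 2 * c) * (G t + - 2 * c))))); last first.
  { intros t _; unfold W; fold c; unfold k; simpl; field. }
  rewrite (is_RInt_unique _ _ _ _ HF); unfold F.
  (* The factor [sin (nu * t)] of [F] vanishes at both endpoints. *)
  replace (nu * (T / 2)) with PI by lra.
  replace (nu * (- T / 2)) with (- PI) by lra.
  rewrite sin_neg sin_PI; ring.
Qed.

(** * Verification of the parameter relations and conclusion *)

(** Phrased through [Q ^ 2] because the sign of [Q] is left open. *)
Lemma minus_cos_neq_0 (Q x : R) : 1 < Q ^ 2 -> Q - cos x <> 0.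
Proof.
  intros HQ E; pose proof (COS_bound x).
  assert (EQ : Q = cos x) by lra; rewrite EQ in HQ; nra.
Qed.

Theorem proposition3p3p1
  (beta gamma r0 nu nut T phi Q P : R) (G : R -> R)
  (hbeta : 0 < beta) (hgamma : 0 < gamma) (hr0 : 0 < r0) (hnu : 0 < nu)
  (hnut : nut = nu / (r0 * sqrt (gamma / beta)))
  (hnut_range : 0 < nut < sqrt 2)
  (hT : T = 2 * PI / nu)
  (hphi : nut ^ 2 < 2 * cos phi ^ 2)
  (hQ : Q ^ 2 = 2 * cos phi ^ 2 / (2 * cos phi ^ 2 - nut ^ 2))
  (hP : P = nut ^ 2 * Q / cos phi)
  (hG : G = (fun tau : R => P / (Q - cos (nu * tau)))) :
  constrained_critical T (momentum T)
    (fun g : R -> R => Hbar beta gamma r0 T g phi) G /\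
  multiplier_equation beta gamma r0 phi
    (gamma * r0 ^ 2 * (nut ^ 2 - 2 * cos phi ^ 2)) G.
Proof.
  assert (Ha : 0 < nut ^ 2) by (apply pow_lt; tauto).
  assert (Hc : cos phi <> 0) by (intros E; rewrite E in hphi; lra).
  assert (Hnu : nu <> 0) by lra.
  assert (hT' : nu * T = 2 * PI) by (rewrite hT; field; lra).
  assert (Hb : beta * nu ^ 2 = gamma * r0 ^ 2 * nut ^ 2).
  { assert (Hs : 0 < sqrt (gamma / beta))
      by (apply sqrt_lt_R0, Rdiv_lt_0_compat; lra).
    assert (Es : sqrt (gamma / beta) ^ 2 = gamma / beta)
      by (apply pow2_sqrt, Rlt_le, Rdiv_lt_0_compat; lra).
    assert (Enu : nu = nut * r0 * sqrt (gamma / beta))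
      by (rewrite hnut; field; lra).
    rewrite Enu !Rpow_mult_distr Es; field; lra. }
  assert (EQ : nut ^ 2 * Q = P * cos phi) by (rewrite hP; now field).
  (* Both sides equal [2 * nut ^ 4 / (2 * cos phi ^ 2 - nut ^ 2)]. *)
  assert (EP : P ^ 2 = 2 * nut ^ 2 * (Q ^ 2 - 1)).
  { rewrite hP; unfold Rdiv; rewrite !Rpow_mult_distr hQ; field; lra. }
  assert (HQ1 : 1 < Q ^ 2).
  { rewrite hQ; apply Rlt_div_r; lra. }
  pose proof (fun t => minus_cos_neq_0 Q (nu * t) HQ1) as HD.
  assert (Hm : multiplier_equation beta gamma r0 phi
                 (gamma * r0 ^ 2 * (nut ^ 2 - 2 * cos phi ^ 2)) G)
    by (rewrite hG; now apply multiplier_equation_const_div_minus_cos).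
  split; [|exact Hm].
  eapply multiplier_constrained_critical; [| | |exact Hm].
  (* The multiplier is nonzero, in fact negative, by [hphi]. *)
  - assert (0 < gamma * r0 ^ 2) by (apply Rmult_lt_0_compat; [|apply pow_lt]; lra).
    apply Rmult_integral_contrapositive_currified; lra.
  - rewrite hG; now apply smooth_periodic_const_div_minus_cos.
  - rewrite hG; now apply (Hbar_const_div_minus_cos _ _ _ _ nu _ (nut ^ 2)).
Qed.
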